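(* Let $N>10^{(10^{13})}$ be an LG number, and let $p_r$ be the largest prime factor of $N$. Then $$\log N>p_r+\frac{1}{2}\log p_r+\frac{1}{2}-\frac{1}{2\log p_r}.$$
   Context: $\log$ is the natural logarithm, $\gamma$ is the Euler–Mascheroni constant, $\sigma(n)=\sum_{d\mid n}d$, $\rho(n)=\sigma(n)/n$, and $G(n)=\rho(n)/\log\log n$. A counterexample to the Robin hypothesis is an integer $n>5040$ with $G(n)\ge e^{\gamma}$. An LG (largest $G$-value) number is a counterexample $N>5040$ at which $G$ attains its largest value among counterexamples; equivalently, $N>5040$, $G(N)\ge e^\gamma$, and $G(m)\le G(N)$ for all integers $m>5040$. (Existence of LG numbers is not asserted.) *)

(* Defs.v *)
From mathcomp Require Import all_boot all_order all_algebra.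
From mathcomp Require Import all_classical all_reals all_analysis.

Set Implicit Arguments.
Unset Strict Implicit.
Unset Printing Implicit Defensive.

Import Order.TTheory GRing.Theory Num.Theory.
Import numFieldNormedType.Exports.

Local Open Scope classical_set_scope.
Local Open Scope ring_scope.

(* The [n]-th term is [1 + 1/2 + ... + 1/n - ln n]: [series u n] sums the
   first [n] terms of [u], and [harmonic k] is [1/(k+1)]. *)
Definition harmonic_sub_ln (R : realType) (n : nat) : R :=
  series (@harmonic R) n - ln n%:R.

Definition euler_mascheroni (R : realType) : R :=
  limn (@harmonic_sub_ln R).

(* [limn] is a total operator; it is meaningful here because the sequence
   converges. *)
Lemma is_cvg_harmonic_sub_ln (R : realType) : cvgn (@harmonic_sub_ln R).
Proof.
have S k : harmonic_sub_ln R k.+1 =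
    series (@harmonic R) k + k.+1%:R^-1 - ln k.+1%:R.
  by rewrite /harmonic_sub_ln /series /= big_nat_recr.
have pos k : (k.+1%:R : R) \is Num.pos by rewrite posrE ltr0Sn.
suff cv : cvgn [sequence harmonic_sub_ln R n.+1]_n.
  by move/cvg_ex: cv => [l cl]; apply: (cvgP l); rewrite -cvg_shiftS.
apply: nonincreasing_is_cvgn.
  apply/nonincreasing_seqP => n.
  rewrite /= !S [series _ n.+1]/series /= big_nat_recr//=.
  have h : ln (n.+1%:R / n.+2%:R) <= - n.+2%:R^-1 :> R.
    have -> : n.+1%:R / n.+2%:R = 1 - n.+2%:R^-1 :> R.
      have n0 : (n.+2%:R : R) != 0 by rewrite pnatr_eq0.
      by apply: (mulIf n0); rewrite mulrBl divfK// mulVf// mul1r -[n.+2]addn1 natrD addrK.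
    by apply: le_ln1Dx; rewrite ltrN2 invf_lt1 ?ltr0Sn// ltr1n.
  move: h; rewrite ln_div// => h; rewrite /series/= -!addrA !lerD2l.
  by rewrite lerBlDr addrC -opprB lerNr.
have lb n : ln n.+1%:R <= series (@harmonic R) n.
  elim: n => [|n IH]; first by rewrite ln1 /series /= big_nil.
  have -> : n.+2%:R = n.+1%:R * (1 + n.+1%:R^-1) :> R.
    by rewrite mulrDr mulr1 mulfV ?pnatr_eq0// -natr1.
  have v0 : 0 < n.+1%:R^-1 :> R by rewrite invr_gt0 ltr0Sn.
  rewrite lnM ?posrE ?ltr0Sn ?addr_gt0// /series /= big_nat_recr//=.
  by apply: lerD => //; apply: le_ln1Dx; rewrite (lt_trans _ v0)// ltrN10.
exists 0 => _ [n _ <-]; rewrite /= S subr_ge0.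
by apply: (le_trans (lb n)); rewrite lerDl invr_ge0 ler0n.
Qed.

Definition sigma (n : nat) : nat := (\sum_(d <- divisors n) d)%N.

Definition rho (R : realType) (n : nat) : R := (sigma n)%:R / n%:R.

Definition G (R : realType) (n : nat) : R := rho R n / ln (ln n%:R).

Definition robin_counterexample (R : realType) (n : nat) : Prop :=
  (5040 < n)%N /\ expR (euler_mascheroni R) <= G R n.

Definition LG (R : realType) (N : nat) : Prop :=
  robin_counterexample R N /\
  forall m : nat, robin_counterexample R m -> G R m <= G R N.

(* Main.v *)
Require Import Defs.
From mathcomp Require Import all_boot all_order all_algebra.
From mathcomp Require Import all_classical all_reals all_analysis.
From mathcomp Require Import ring lra.

(** Why the theorem is true. Let [p] be a prime factor of [N = p * m], put
    [L = ln N] and [x = ln p], so that [ln m = L - x]. Removing one factor [p]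
    cannot increase [G]: [N] maximises [G] among counterexamples, and an
    [m > 5040] that is not a counterexample has [G m < exp gamma <= G N]
    ([G_le_of_LG]). On the other side [rho N <= (1 + 1/p) * rho m]
    ([rho_prime_mul_le]). The values of [rho] cancel, leaving an inequality
    about logarithms alone ([lnln_le_of_LG]):
      [ln L <= (1 + 1/p) * ln (L - x)],  i.e.
      [p * (ln L - ln (L - x)) <= ln (L - x)].

    This forces [L] to be large. To second order
    [ln L - ln (L - x) >= x/L + x^2 / (2 L^2)]. With [L = p + delta] the
    inequality becomes, up to terms of size [O(x^3 / p)],
      [x^2/2 + x <= delta * (x + 1)],
    so [delta >= x/2 + 1/2 - 1/(2 (x+1))] up to that error. The value
    [D = x/2 + 1/2 - 1/(2x)] that is to be beaten falls short of this by
    [1/(2 x (x+1))], while [p = exp x] is far larger than any power of [x] in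
    play; [lower_bound_of_lnln_le] turns this into a contradiction from
    [L <= p + D].

    The argument needs [p] not too small and [m > 5040]. If [p] is at most half
    of [10^13], the bound follows from [L > 10^13]. If [p] is large but
    [m <= 5040], then [rho N <= (1 + 1/p) * (1 + ln 5040)] is below 18, whereas
    a counterexample has [rho N >= exp gamma * ln L >= ln (10^13) > 21]; this
    uses [rho m <= 1 + ln m] ([rho_le_ln]) and [gamma >= 0]
    ([euler_mascheroni_ge0]). *)

Set Implicit Arguments.
Unset Strict Implicit.
Unset Printing Implicit Defensive.

Import Order.TTheory GRing.Theory Num.Theory.
Import numFieldNormedType.Exports.

Local Open Scope ring_scope.

(** * Estimates for the logarithm and the exponential *)

(** Second-order Taylor bound at 1. The first-order bound [ln u <= u - 1] would
    lose the term [1/2 * ln p] of the theorem. The difference of the two sides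
    vanishes at 1 and has derivative [(1 - v)^2 / v >= 0]. *)
Lemma ln_le_quadratic (R : realType) (u : R) : 0 < u -> u <= 1 ->
  ln u <= - ((1 - u) + (1 - u) ^+ 2 / 2).
Proof.
move=> u0 u1.
pose f (v : R) : R := ln v + ((1 - v) + (1 - v) ^+ 2 / 2).
pose df (v : R) : R := (1 - v) ^+ 2 / v.
have D (v : R) : 0 < v -> is_derive v 1 f (df v).
  move=> v0; rewrite /f; apply: is_derive_eq.
    apply: is_deriveD; first exact: is_derive1_ln.
  rewrite /df /GRing.scale /=; field; exact: lt0r_neq0.
have cf : {within `[u, 1%R], continuous f}%classic.
  apply: derivable_within_continuous => v; rewrite in_itv /= => /andP[uv _].
  by have [] := D v (lt_le_trans u0 uv).
have Do : forall v, v \in `]u, 1%R[%R -> is_derive v 1 f (df v).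
  by move=> v; rewrite in_itv /= => /andP[uv _]; apply: D; exact: lt_trans uv.
have [c] := MVT_segment u1 Do cf.
rewrite in_itv /= => /andP[uc _] E.
have c0 : 0 < c by exact: lt_le_trans uc.
have : 0 <= f 1 - f u by rewrite E mulr_ge0 ?subr_ge0// divr_ge0 ?sqr_ge0// ltW.
rewrite /f ln1; lra.
Qed.

Lemma ln2_ge (R : realType) : 5 / 8 <= ln (2 : R).
Proof.
have := @ln_le_quadratic R 2^-1; rewrite lnV ?posrE //; lra.
Qed.

Lemma ln2_le1 (R : realType) : ln (2 : R) <= 1.
Proof. by have := @le_ln1Dx R 1; rewrite -[1 + 1]/(2 : R); apply; lra. Qed.

Lemma ln_ge_log2 (R : realType) (n : nat) (y : R) :
  2 ^+ n <= y -> n%:R * (5 / 8) <= ln y.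
Proof.
move=> ny; have y0 : 0 < 2 ^+ n :> R by rewrite exprn_gt0.
apply: (@le_trans _ _ (ln (2 ^+ n))); last first.
  by rewrite ler_ln ?posrE // (lt_le_trans y0).
by rewrite lnXn // -[ln 2 *+ n]mulr_natl ler_wpM2l // ln2_ge.
Qed.

Lemma ln_le_log2 (R : realType) (n : nat) (y : R) :
  0 < y -> y <= 2 ^+ n -> ln y <= n%:R.
Proof.
move=> y0 yn; apply: (@le_trans _ _ (ln (2 ^+ n))).
  by rewrite ler_ln ?posrE // exprn_gt0.
by rewrite lnXn // -[leRHS]mulr1 mulr_natl lerMn2r ln2_le1 orbT.
Qed.

Lemma ln_gt1 (R : realType) (y : R) : 8 <= y -> 1 < ln y.
Proof.
move=> y8; have /ln_ge_log2 : 2 ^+ 3 <= y by apply: le_trans y8; lra.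
lra.
Qed.

(** With [x = 4 y], it suffices that [4 y < 1 + y^3/6 <= expR y], which holds
    from [y = 5] on; a direct comparison with a single Taylor term of [expR x]
    would need a large factorial. *)
Lemma exp4_lt_expR (R : realType) (x : R) : 20 <= x -> x ^+ 4 < expR x.
Proof.
move=> x20; pose y := x / 4.
have y5 : 5 <= y by rewrite /y; lra.
have -> : x = 4 * y by rewrite /y; lra.
rewrite expRM_natl ltrXn2r // ?nnegrE ?expR_ge0 //; first by lra.
have y0 : 0 <= y by lra.
apply: lt_le_trans (expR_ge1Dxn 2 y0).
rewrite -[3`!]/6%N.
have yy : 25 <= y * y.
  have : 5 * 5 <= y * y by rewrite ler_pM.
  by lra.
have : 25 * y <= y * y * y by rewrite ler_wpM2r.
rewrite exprSr expr2; lra.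
Qed.

(** * Harmonic numbers and Euler's constant *)

Lemma invS_le_ln (R : realType) (n : nat) :
  (n.+2%:R : R)^-1 <= ln n.+2%:R - ln n.+1%:R.
Proof.
rewrite -ln_div ?posrE ?ltr0Sn // -lerN2 -lnV ?posrE ?divr_gt0 ?ltr0Sn //.
have n2 : n.+2%:R != 0 :> R by rewrite pnatr_eq0.
have -> : (n.+2%:R / n.+1%:R)^-1 = 1 + (- n.+2%:R^-1) :> R.
  rewrite invf_div; apply: (mulIf n2).
  by rewrite divfK // mulrDl mulNr mulVf // mul1r -[n.+2]addn1 natrD addrK.
by apply: le_ln1Dx; rewrite ltrN2 invf_lt1 ?ltr0Sn// ltr1n.
Qed.

Lemma harmonic_le_ln (R : realType) (n : nat) :
  series (@harmonic R) n.+1 <= 1 + ln n.+1%:R.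
Proof.
elim: n => [|n IH]; first by rewrite /series /= big_nat1 ln1 addr0 invr1.
rewrite /series /= big_nat_recr //=.
apply: le_trans (lerD IH (invS_le_ln R n)) _.
by rewrite -addrA lerD2l addrC subrK.
Qed.

Lemma lnS_le_harmonic (R : realType) (n : nat) :
  ln n.+1%:R <= series (@harmonic R) n.
Proof.
elim: n => [|n IH]; first by rewrite ln1 /series /= big_nil.
have -> : n.+2%:R = n.+1%:R * (1 + n.+1%:R^-1) :> R.
  by rewrite mulrDr mulr1 mulfV ?pnatr_eq0// -natr1.
have v0 : 0 < n.+1%:R^-1 :> R by rewrite invr_gt0 ltr0Sn.
rewrite lnM ?posrE ?ltr0Sn ?addr_gt0// /series /= big_nat_recr//=.
by apply: lerD => //; apply: le_ln1Dx; rewrite (lt_trans _ v0)// ltrN10.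
Qed.

Lemma euler_mascheroni_ge0 (R : realType) : 0 <= euler_mascheroni R.
Proof.
apply: limr_ge; first exact: is_cvg_harmonic_sub_ln.
exists 1%N => // -[//|n] _ /=; rewrite /harmonic_sub_ln subr_ge0.
apply: le_trans (lnS_le_harmonic R n) _.
by rewrite /series /= big_nat_recr //= lerDl invr_ge0.
Qed.

(** * The sum-of-divisors function *)

(** A divisor of [p * m] is either prime to [p], and then divides [m], or of
    the form [p * e] with [e] dividing [m]. Equality holds when [p] does not
    divide [m]. *)
Lemma sigma_prime_mul_le (p m : nat) : prime p -> (0 < m)%N ->
  (sigma (p * m) <= p.+1 * sigma m)%N.
Proof.
move=> pp m0; have p0 := prime_gt0 pp.
have pm0 : (0 < p * m)%N by rewrite muln_gt0 p0.
rewrite /sigma (bigID (fun d => p %| d)%N) /= mulSn addnC leq_add //.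
  apply: (@uniq_sub_le_big_cond _ addn leq leqnn (fun a b => leq_addr b a) 0%N _ _ _
    (fun d => ~~ (p %| d))%N xpredT); rewrite ?filter_predT ?filter_uniq ?divisors_uniq //.
  move=> d; rewrite mem_filter -!dvdn_divisors // => /andP[pd].
  by rewrite Gauss_dvdr // coprime_sym prime_coprime.
rewrite big_distrr /= -(big_map (muln p) xpredT id).
have pI : injective (muln p) by move=> i j /eqP; rewrite eqn_pmul2l // => /eqP.
apply: (@uniq_sub_le_big_cond _ addn leq leqnn (fun a b => leq_addr b a) 0%N _ _ _
    (fun d => p %| d)%N xpredT); rewrite ?filter_predT ?filter_uniq ?map_inj_uniq ?divisors_uniq //.
move=> d; rewrite mem_filter -!dvdn_divisors // => /andP[/dvdnP[e ->]].
by rewrite mulnC dvdn_pmul2l // => em; apply: map_f; rewrite -dvdn_divisors.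
Qed.

Lemma rho_prime_mul_le (R : realType) (p m : nat) : prime p -> (0 < m)%N ->
  rho R (p * m) <= (1 + p%:R^-1) * rho R m.
Proof.
move=> pp m0; have p0 : 0 < p%:R :> R by rewrite ltr0n prime_gt0.
have mR0 : 0 < m%:R :> R by rewrite ltr0n.
rewrite /rho natrM ler_pdivrMr ?mulr_gt0 //.
have -> : (1 + p%:R^-1) * ((sigma m)%:R / m%:R) * (p%:R * m%:R)
    = p.+1%:R * (sigma m)%:R :> R.
  by rewrite -natr1; field; rewrite !lt0r_neq0.
by rewrite -natrM ler_nat sigma_prime_mul_le.
Qed.

(** Reindexing by the complementary divisor turns [sigma m] into the sum of
    [m %/ k] over the divisors [k] of [m], to which the other [k <= m] are then
    added. *)
Lemma sigma_le_sum_div (m : nat) : (0 < m)%N ->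
  (sigma m <= \sum_(0 <= k < m) m %/ k.+1)%N.
Proof.
move=> m0; rewrite /sigma.
have dd (d : nat) : d \in divisors m -> (d = m %/ (m %/ d))%N.
  by rewrite -dvdn_divisors // => dm; rewrite divnA // mulKn.
rewrite (eq_big_seq (fun d => m %/ (m %/ d))%N); last exact: dd.
rewrite -(big_map (divn m) xpredT (divn m)).
rewrite -(big_add1 _ _ 0 m.+1 xpredT (divn m)).
apply: (uniq_sub_le_big leqnn (fun a b => leq_addr b a)); rewrite ?iota_uniq //.
  by rewrite map_inj_in_uniq ?divisors_uniq // => i j /dd {2}-> /dd {2}-> ->.
move=> _ /mapP[d + ->]; rewrite -dvdn_divisors // => dm.
have d0 := dvdn_gt0 m0 dm.
by rewrite mem_index_iota ltnS leq_div andbT divn_gt0 // dvdn_leq.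
Qed.

(** [rho m] is the sum of the inverses of the divisors of [m], hence at most
    the [m]-th harmonic number. *)
Lemma rho_le_ln (R : realType) (m : nat) : (0 < m)%N -> rho R m <= 1 + ln m%:R.
Proof.
case: m => // m _; apply: le_trans (harmonic_le_ln R m).
rewrite /rho ler_pdivrMr ?ltr0Sn // /series /= mulr_suml.
apply: (@le_trans _ _ (\sum_(0 <= k < m.+1) m.+1 %/ k.+1)%N%:R).
  by rewrite ler_nat sigma_le_sum_div.
rewrite natr_sum; apply: ler_sum => k _.
rewrite /harmonic /= ler_pdivlMl ?ltr0Sn // -natrM ler_nat mulnC.
exact: leq_trunc_div.
Qed.

(** * Maximality of G at an LG number *)

(** The maximum of [G] over counterexamples is also its maximum over all
    integers above 5040: the others have [G m < exp gamma <= G N]. *)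
Lemma G_le_of_LG (R : realType) (N m : nat) : LG R N -> (5040 < m)%N -> G R m <= G R N.
Proof.
move=> [[_ eN] maxN] m5.
have [mc|/ltW mN] := leP (expR (euler_mascheroni R)) (G R m); first exact: maxN.
exact: le_trans eN.
Qed.

(** Comparing [G (p * m)] with [G m] and cancelling [rho m]. *)
Lemma lnln_le_of_LG (R : realType) (p m : nat) :
  LG R (p * m) -> prime p -> (5040 < m)%N ->
  ln (ln (p * m)%:R) <= (1 + p%:R^-1) * ln (ln m%:R : R).
Proof.
move=> hLG pp m5.
have m8 : (8 <= m)%N by apply: leq_trans m5.
have m0 : (0 < m)%N by apply: leq_trans m8.
have lm1 : 1 < ln m%:R :> R by apply: ln_gt1; rewrite ler_nat.
have llm0 : 0 < ln (ln m%:R : R) by apply: ln_gt0.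
have lN1 : 1 < ln (p * m)%:R :> R.
  by apply: ln_gt1; rewrite ler_nat (leq_trans m8) // leq_pmull // prime_gt0.
have llN0 : 0 < ln (ln (p * m)%:R : R) by apply: ln_gt0.
have rm0 : 0 < rho R m.
  rewrite divr_gt0 // ltr0n // /sigma (bigD1_seq m) ?divisors_uniq ?divisors_id //=.
  by rewrite ltn_addr.
have := G_le_of_LG hLG m5; rewrite /G ler_pdivrMr // mulrAC ler_pdivlMr // => H.
rewrite -(ler_pM2l rm0).
apply: le_trans (le_trans H (ler_wpM2r (ltW llm0) (rho_prime_mul_le R pp m0))) _.
by rewrite [leRHS]mulrCA mulrA.
Qed.

(** * Lower bound for ln N *)

(** The analytic core: [ln L <= (1 + 1/p) ln (L - ln p)] bounds [L] from below.
    With [M = p + D] the negated conclusion is [L <= M]. The left-hand side of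
    [p * (ln L - ln (L - x)) <= ln (L - x)] decreases with [L] and the right-hand
    side increases, so [L] can be replaced by [M] after the logarithms have been
    estimated. In the resulting inequality the choice of [D] makes
    [x^2/2 + x - D - D x] equal to [1/(2x)], which has to be at most
    [x^2 D / (2 p)]; then [p <= x^3 D < x^4], against [p = expR x]. *)
Lemma lower_bound_of_lnln_le (R : realType) (p L : R) :
  0 < p -> 20 <= ln p -> ln p < L ->
  ln L <= (1 + p^-1) * ln (L - ln p) ->
  p + 1 / 2 * ln p + 1 / 2 - 1 / (2 * ln p) < L.
Proof.
move=> p0; set x := ln p => x20 xL H; rewrite ltNge; apply/negP => LM.
have x0 : 0 < x by lra.
have L0 : 0 < L by lra.
pose D := 1 / 2 * x + 1 / 2 - 1 / (2 * x).
have DE : D * (2 * x) = x ^+ 2 + x - 1 by rewrite /D; field; exact: lt0r_neq0.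
have D0 : 0 < D by rewrite -(pmulr_lgt0 _ (_ : 0 < 2 * x)) ?DE; nra.
have Dx : D < x by rewrite -(ltr_pM2r (_ : 0 < 2 * x)) ?DE; nra.
have {}LM : L <= p + D by rewrite /D; lra.
have M0 : 0 < p + D by lra.
have pexp : x ^+ 4 < p by rewrite -(lnK (_ : p \in Num.pos)) ?posrE // exp4_lt_expR.
have q0 : 0 < p^-1 by rewrite invr_gt0.
have qp : p * p^-1 = 1 by rewrite mulfV // lt0r_neq0.
pose t := x / L; pose s := x / (p + D).
have t0 : 0 < t by rewrite divr_gt0.
have lnA : ln (L - x) <= ln L - (t + t ^+ 2 / 2).
  have -> : L - x = L * (1 - t) by rewrite /t; field; exact: lt0r_neq0.
  have t1 : t < 1 by rewrite ltr_pdivrMr // mul1r.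
  rewrite lnM ?posrE ?subr_gt0 // lerD2l.
  by apply: le_trans (ln_le_quadratic _ _) _; lra.
have lnM' : ln (L - x) <= x + (D - x) * p^-1.
  apply: (@le_trans _ _ (ln (p * (1 + (D - x) * p^-1)))).
    have -> : p * (1 + (D - x) * p^-1) = p + D - x by field; exact: lt0r_neq0.
    by rewrite ler_ln ?posrE; lra.
  have e0 : 0 < 1 + (D - x) * p^-1.
    by rewrite -(pmulr_rgt0 _ p0) mulrDr mulrCA qp; lra.
  by rewrite lnM ?posrE // lerD2l le_ln1Dx //; lra.
have s0 : 0 < s by rewrite divr_gt0.
have st : s <= t by rewrite /s /t ler_pM2l // lef_pV2 ?posrE.
have st2 : s + s ^+ 2 / 2 <= t + t ^+ 2 / 2.
  have : s ^+ 2 <= t ^+ 2 by rewrite lerXn2r // nnegrE ltW.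
  lra.
have H1 : s + s ^+ 2 / 2 <= p^-1 * (x + (D - x) * p^-1).
  have : p^-1 * ln (L - x) <= p^-1 * (x + (D - x) * p^-1) by rewrite ler_pM2l.
  lra.
have H2 : p * x + p * x ^+ 2 / (2 * (p + D)) <= (p + D) * (x + (D - x) * p^-1).
  have pM0 : 0 <= p * (p + D) by rewrite mulr_ge0 ?ltW.
  have := ler_wpM2l pM0 H1.
  have -> : p * (p + D) * (s + s ^+ 2 / 2)
      = p * x + p * x ^+ 2 / (2 * (p + D)).
    by rewrite /s; field; exact: lt0r_neq0.
  by rewrite [p * (p + D)]mulrC -[_ * p * _]mulrA mulVKf ?lt0r_neq0.
(* From p^2 >= (p + D)(p - D). *)
have H3 : x ^+ 2 / 2 * (1 - D / p) <= p * x ^+ 2 / (2 * (p + D)).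
  rewrite ler_pdivlMr ?mulr_gt0 //.
  have -> : x ^+ 2 / 2 * (1 - D / p) * (2 * (p + D)) =
      p * x ^+ 2 - x ^+ 2 * D ^+ 2 / p.
    by field; exact: lt0r_neq0.
  by rewrite gerDl oppr_le0 divr_ge0 ?mulr_ge0 ?sqr_ge0 ?ltW.
have H4 : 0 <= D * ((x - D) * p^-1) by rewrite !mulr_ge0 ?ltW // subr_gt0.
have H5 : x ^+ 2 / 2 + x - D - D * x <= x ^+ 2 / 2 * (D / p).
  have E1 : (p + D) * (x + (D - x) * p^-1) =
      p * x + D * x + (D - x) - D * ((x - D) * p^-1).
    by field; exact: lt0r_neq0.
  by move: H2 H3; rewrite E1 mulrBr mulr1; lra.
(* Multiply by 2 x p; by DE the left-hand side becomes p. *)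
have H6 : p <= x ^+ 3 * D.
  have := ler_wpM2l (ltW (mulr_gt0 (mulr_gt0 (ltr0Sn R 1) x0) p0)) H5.
  have -> : 2 * x * p * (x ^+ 2 / 2 * (D / p)) = x ^+ 3 * D.
    by field; exact: lt0r_neq0.
  suff -> : 2 * x * p * (x ^+ 2 / 2 + x - D - D * x) = p by [].
  have -> : 2 * x * p * (x ^+ 2 / 2 + x - D - D * x) =
    p * (x ^+ 3 + 2 * x ^+ 2 - (x + 1) * (D * (2 * x))) by field.
  by rewrite DE; ring.
have : x ^+ 3 * D <= x ^+ 4 by rewrite [x ^+ 4]exprSr ler_pM2l ?exprn_gt0 // ltW.
lra.
Qed.

(** The three cases are: [p] small, where the size of [N] suffices; [p] large
    with cofactor above 5040, where [m] competes with [N]; and [p] large with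
    [m <= 5040], where [rho N] is too small for a counterexample. The threshold
    21 leaves [ln p >= 21 - ln 2 >= 20] in the last two. *)
Lemma prime_factor_lt_ln_of_LG (R : realType) (K p m : nat) :
  21 <= ln (K%:R : R) -> (10 ^ K < p * m)%N -> LG R (p * m) -> prime p ->
  p%:R + 1 / 2 * ln p%:R + 1 / 2 - 1 / (2 * ln p%:R) < ln (p * m)%:R :> R.
Proof.
move=> lK KN hLG pp; set N := (p * m)%N in KN hLG *.
set k : R := K%:R; set P : R := p%:R; set x := ln P.
have N0 : (0 < N)%N by apply: leq_ltn_trans KN.
have m0 : (0 < m)%N by move: N0; rewrite muln_gt0 => /andP[].
have k0 : 0 < k by rewrite ltNge; apply/negP => /ln0 e; move: lK; rewrite e; lra.
have k21 : 21 < k by apply: le_lt_trans lK (ln_sublinear k0).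
(* 2^3 <= 10 is precise enough. *)
have ln10 : 1 <= ln (10 : R).
  have : (3 : nat)%:R * (5 / 8) <= ln (10 : R) by apply: ln_ge_log2; lra.
  by lra.
have kL : k < ln N%:R.
  apply: (@le_lt_trans _ _ (ln ((10 : R) ^+ K))).
    by rewrite lnXn // -[leRHS]mulr_natl ler_peMr // ltW.
  by rewrite ltr_ln ?posrE ?exprn_gt0 ?ltr0n // -natrX ltr_nat.
have P2 : 2 <= P by rewrite ler_nat prime_gt1.
have P0 : 0 < P by lra.
have x0 : 0 < x by apply: ln_gt0; lra.
have xP : x < P by apply: ln_sublinear.
have [Pk|kP] := leP P (k / 2).
  have : 0 < 1 / (2 * x) by rewrite divr_gt0 // mulr_gt0.
  by lra.
have x20 : 20 <= x.
  have : ln k - ln 2 <= x.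
    by rewrite -ln_div ?posrE // ler_ln ?posrE ?divr_gt0 // ltW.
  by have := ln2_le1 R; lra.
have NE : ln N%:R = x + ln m%:R by rewrite /N natrM lnM ?posrE // ltr0n.
have [m5|m5] := ltnP 5040 m.
  have lm1 : 1 < ln m%:R :> R.
    by apply: ln_gt1; rewrite ler_nat; apply: leq_trans m5.
  apply: lower_bound_of_lnln_le => //; first by rewrite NE ltrDl; lra.
  have -> : ln N%:R - ln P = ln m%:R by rewrite NE addrAC subrr add0r.
  exact: lnln_le_of_LG.
have lm : ln m%:R <= 13 :> R.
  (* 5040 <= 2^13 *)
  apply: (@ln_le_log2 _ 13); rewrite ?ltr0n // -natrX ler_nat.
  by apply: leq_trans m5 _; vm_compute.
have lnL : 21 < ln (ln N%:R : R).
  by apply: le_lt_trans lK _; rewrite ltr_ln ?posrE // (lt_trans k0).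
have lnL0 : 0 < ln (ln N%:R : R) by lra.
have : ln (ln N%:R) <= rho R N.
  have [[_ eG] _] := hLG; move: eG; rewrite /G ler_pdivlMr // => eG.
  apply: (le_trans _ eG); rewrite ler_peMl ?(ltW lnL0) //.
  by rewrite -expR0 ler_expR euler_mascheroni_ge0.
have := rho_prime_mul_le R pp m0; rewrite -/N -/P.
have := rho_le_ln R m0.
have r0 : 0 <= rho R m by rewrite divr_ge0.
have P4 : P^-1 <= 4^-1 by rewrite lef_pV2 ?posrE //; lra.
have := ler_wpM2r r0 P4.
lra.
Qed.

Theorem theorem6 (R : realType) (N pr : nat)
    (hN : (10 ^ (10 ^ 13) < N)%N) (hLG : LG R N) (hpr : pr = max_pdiv N) :
  ln (N%:R : R) >
    pr%:R + 1 / 2 * ln pr%:R + 1 / 2 - 1 / (2 * ln pr%:R).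
Proof.
have N1 : (1 < N)%N.
  by case: hLG => -[N5 _] _; apply: leq_trans N5.
have pp : prime pr by rewrite hpr max_pdiv_prime.
have /dvdnP[m NE] : (pr %| N)%N by rewrite hpr max_pdiv_dvd.
rewrite mulnC in NE; rewrite {}NE in hN hLG *.
apply: prime_factor_lt_ln_of_LG hN hLG pp.
(* ln (10^13) = 13 ln 10 >= 13 * 15/8 > 21. *)
rewrite natrX lnXn // -mulr_natl.
have : (3 : nat)%:R * (5 / 8) <= ln (10 : R) by apply: ln_ge_log2; lra.
lra.
Qed.
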